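(* Let $n\ge 2$ and let $B_{2,\lfloor 3^n/2\rfloor}$ be the banana tree formed by joining one leaf of each of two disjoint copies of a star on $\lfloor 3^n/2\rfloor$ vertices to a new root vertex (so it has $3^n$ vertices). Then \[WL\Big(Q_n^3, B_{2,\lfloor 3^n/2\rfloor}\Big)=4n\Big( \Big\lceil\frac{3^n}{2}\Big\rceil-3\Big)+4\Big( \Big\lceil\frac{3^n}{2}\Big\rceil-2\Big)+4\Big( \Big\lceil\frac{3^n}{2}\Big\rceil-1\Big).\]
   Context: $Q_n^3$ is the graph on $\{0,1,2\}^n$ in which two tuples are adjacent iff they differ in exactly one coordinate $j$ and there $x_j\equiv y_j\pm1\pmod 3$. For a bijection $f:V(G)\to V(T)$ into a tree $T$, $WL_f(G,T)$ is the sum over edges $(u,v)$ of $G$ of the distance in $T$ between $f(u)$ and $f(v)$, and $WL(G,T)=\min_f WL_f(G,T)$. *)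

(* Defs.v *)
From mathcomp Require Export all_boot.

Set Implicit Arguments.
Unset Strict Implicit.
Unset Printing Implicit Defensive.

Record sgraph := SGraph {
  svertex :> finType;
  sedge : rel svertex;
  sedge_sym : symmetric sedge;
  sedge_irrefl : irreflexive sedge }.

Definition walk_of_length (G : sgraph) (x y : G) (d : nat) : bool :=
  [exists p : d.-tuple G, path (@sedge G) x p && (last x p == y)].

(* A shortest walk has length < #|G|; the value #|G| is only taken when y is
   not reachable from x. *)
Definition gdist (G : sgraph) (x y : G) : nat :=
  \big[minn/#|G|]_(d < #|G| | walk_of_length x y d) d.

(* Comparing ranks in the enumeration of the vertices counts each
   (undirected) edge exactly once. *)
Definition WLf (G T : sgraph) (f : G -> T) : nat :=
  \sum_(p : G * G | sedge p.1 p.2 && (enum_rank p.1 < enum_rank p.2))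
     gdist (f p.1) (f p.2).

(* WL(G,T) = w, as a relation: w is attained, so a bijection has to exist. *)
Definition WL_eq (G T : sgraph) (w : nat) : Prop :=
  (exists f : G -> T, bijective f /\ WLf f = w) /\
  (forall f : G -> T, bijective f -> w <= WLf f).

Section TernaryCube.
Variable n : nat.

Definition Q3_adj (x y : {ffun 'I_n -> 'I_3}) : bool :=
  (#|[set j | x j != y j]| == 1) &&
  [forall j, (x j != y j) ==>
     ((x j == y j + 1 %[mod 3]) || (x j + 1 == y j %[mod 3]))].

Lemma Q3_adj_sym : symmetric Q3_adj.
Proof.
move=> x y; rewrite /Q3_adj; congr (_ && _).
  by congr (_ == _); apply: eq_card => j; rewrite !inE eq_sym.
apply: eq_forallb => j; rewrite eq_sym orbC.
by congr (_ ==> (_ || _)); rewrite eq_sym.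
Qed.

Lemma Q3_adj_irrefl : irreflexive Q3_adj.
Proof.
move=> x; rewrite /Q3_adj (_ : [set j | _] = set0) ?cards0 //.
by apply/setP => j; rewrite !inE eqxx.
Qed.

Definition Q3 : sgraph := SGraph Q3_adj_sym Q3_adj_irrefl.

End TernaryCube.

Section Banana.
Variables m k : nat.

(* Star on 'I_k with centre 0. *)
Definition star_adj (a b : 'I_k) : bool :=
  (a != b) && ((a == 0 :> nat) || (b == 0 :> nat)).

(* B_{m,k}: None is the root, Some (i, a) is vertex a of the i-th star, and
   a = 1 is the leaf of that star joined to the root (meaningful for k >= 2). *)
Definition banana_adj (u v : option ('I_m * 'I_k)) : bool :=
  match u, v with
  | None, None => false
  | None, Some (_, b) => b == 1 :> nat
  | Some (_, a), None => a == 1 :> nat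
  | Some (i, a), Some (j, b) => (i == j) && star_adj a b
  end.

Lemma banana_adj_sym : symmetric banana_adj.
Proof.
move=> [[i a]|] [[j b]|] //=.
by rewrite /star_adj (eq_sym i) (eq_sym a) orbC.
Qed.

Lemma banana_adj_irrefl : irreflexive banana_adj.
Proof. by move=> [[i a]|] //=; rewrite /star_adj !eqxx. Qed.

Definition banana : sgraph := SGraph banana_adj_sym banana_adj_irrefl.

End Banana.

(* Main.v *)
Require Import Defs.
From mathcomp Require Import all_boot zify.

(** In a tree the wirelength is the sum, over the tree edges, of the edge boundary
    in the cube of the vertices placed on one side of that edge. The [2 (k - 2)] pendant
    edges, [k = 3 ^ n %/ 2], each contribute the degree [2 n]; the other four edges
    form the spine and cut off sets of [k - 1], [k], [k + 1], [k + 2] vertices.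
    By Lindsey's theorem initial lexicographic segments minimise the boundary,
    which gives [2 (k - 1)], [2 k], [2 k], [2 (k - 1)]; as these segments are nested,
    one placement is optimal for the four cuts at once. Lindsey's theorem follows by
    induction on the dimension from a superadditivity property of the number of
    edges induced on an initial segment. *)

(** * Ternary digit sums and edges induced on initial segments *)

Fixpoint digitsum_rec (fuel m : nat) : nat :=
  if fuel is fuel'.+1 then m %% 3 + digitsum_rec fuel' (m %/ 3) else 0.

Definition digitsum (m : nat) : nat := digitsum_rec m m.

Lemma digitsum_rec0 (f : nat) : digitsum_rec f 0 = 0.
Proof. by elim: f => //= f IH; rewrite mod0n div0n. Qed.

Lemma digitsum_rec_fuel (f g m : nat) :
  m <= f -> m <= g -> digitsum_rec f m = digitsum_rec g m.
Proof.
elim: f g m => [|f IH] [|g] m //=.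
- by case: m => // _ _; rewrite mod0n div0n digitsum_rec0.
- by case: m => // _ _; rewrite mod0n div0n digitsum_rec0.
- by move=> le_mf le_mg; rewrite (IH g) //; lia.
Qed.

Lemma digitsum_digit (q r : nat) : r < 3 -> digitsum (3 * q + r) = digitsum q + r.
Proof.
move=> r3; case: (posnP (3 * q + r)) => [e|m_gt0].
  by have [-> ->] : q = 0 /\ r = 0 by lia.
rewrite -(prednK m_gt0) {1}/digitsum /= prednK //.
have -> : (3 * q + r) %/ 3 = q by lia.
have -> : (3 * q + r) %% 3 = r by lia.
by rewrite addnC (digitsum_rec_fuel _ q) //; lia.
Qed.

(** Each carry replaces a trailing 2 by 0, so carrying only lowers the digit sum. *)
Lemma digitsumS_le (m : nat) : digitsum m.+1 <= (digitsum m).+1.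
Proof.
elim/ltn_ind: m => m IH.
have Em : m = 3 * (m %/ 3) + m %% 3 by lia.
have r3 : m %% 3 < 3 by lia.
move: (m %/ 3) (m %% 3) Em r3 => q r -> {m} r3 in IH *.
case: (ltnP r 2) => r2; first by rewrite -addnS !digitsum_digit //; lia.
have -> : (3 * q + r).+1 = 3 * q.+1 + 0 by lia.
rewrite !digitsum_digit //.
by have := IH q; lia.
Qed.

(* A vertex with lexicographic rank [i] has [digitsum i] neighbours of smaller
   rank, so this counts the edges induced on the first [a] vertices. *)
Definition lexedges (a : nat) : nat := \sum_(i < a) digitsum i.

Lemma lexedges0 : lexedges 0 = 0.
Proof. by rewrite /lexedges big_ord0. Qed.

Lemma lexedgesS (a : nat) : lexedges a.+1 = lexedges a + digitsum a.
Proof. by rewrite /lexedges big_ord_recr. Qed.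

(** Grouping ranks by their last digit gives three layers of $q$ vertices joined by $q$ triangles.
    The next two lemmas treat layers of sizes $q+1,q,q$ and $q+1,q+1,q$. *)
Lemma lexedges_mul3 (q : nat) : lexedges (3 * q) = 3 * lexedges q + 3 * q.
Proof.
elim: q => [|q IH]; first by rewrite muln0 lexedges0.
have -> : 3 * q.+1 = (3 * q).+3 by lia.
rewrite !lexedgesS IH.
have := digitsum_digit q 0 isT; have := digitsum_digit q 1 isT.
have := digitsum_digit q 2 isT; rewrite addn0 addn1 addn2; lia.
Qed.

Lemma lexedges_mul3D1 (q : nat) :
  lexedges (3 * q).+1 = 2 * lexedges q + lexedges q.+1 + 3 * q.
Proof.
rewrite !lexedgesS lexedges_mul3.
have := digitsum_digit q 0 isT; rewrite addn0; lia.
Qed.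

Lemma lexedges_mul3D2 (q : nat) :
  lexedges (3 * q).+2 = lexedges q + 2 * lexedges q.+1 + 3 * q + 1.
Proof.
rewrite lexedgesS lexedges_mul3D1 lexedgesS.
have := digitsum_digit q 1 isT; rewrite addn1; lia.
Qed.

(** For [a <= 1] this is the last-digit layering, with equality. The range up to 3 accommodates the
    sum of three remainders in [lexedges_superadditive]. After expansion by last digit, only the
    digit sums of $q$, $q+1$, $q+2$ remain to be compared. *)
Lemma lexedges_near_balanced (q a b : nat) : b <= a <= 3 ->
  lexedges (q + a) + lexedges (q + b) + lexedges q + 3 * q + b
    <= lexedges (3 * q + a + b).
Proof.
have s0 := digitsumS_le q; have s1 := digitsumS_le q.+1.
have E4 : lexedges (3 * q).+4 = 2 * lexedges q.+1 + lexedges q.+2 + 3 * q + 3.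
  have := lexedges_mul3D1 q.+1; have -> : (3 * q.+1).+1 = (3 * q).+4 by lia.
  lia.
have E3 : lexedges (3 * q).+3 = 3 * lexedges q.+1 + 3 * q + 3.
  have := lexedges_mul3 q.+1; have -> : 3 * q.+1 = (3 * q).+3 by lia.
  lia.
have E5 : lexedges (3 * q).+4.+1 = lexedges q.+1 + 2 * lexedges q.+2 + 3 * q + 4.
  have := lexedges_mul3D2 q.+1; have -> : (3 * q.+1).+2 = (3 * q).+4.+1 by lia.
  lia.
have E6 : lexedges (3 * q).+4.+2 = 3 * lexedges q.+2 + 3 * q + 6.
  have := lexedges_mul3 q.+2; have -> : 3 * q.+2 = (3 * q).+4.+2 by lia.
  lia.
have E0 := lexedges_mul3 q; have E1 := lexedges_mul3D1 q.
have E2 := lexedges_mul3D2 q.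
have F1 := lexedgesS q; have F2 := lexedgesS q.+1; have F3 := lexedgesS q.+2.
case: a => [|[|[|[|a]]]]; case: b => [|[|[|[|b]]]] //= le_ba; try lia;
  rewrite ?(addnS, addSn, addn0); lia.
Qed.

Lemma ternary_split (x : nat) : exists q b a : nat,
  [/\ b <= a <= 1, x = 3 * q + a + b &
      lexedges x = lexedges (q + a) + lexedges (q + b) + lexedges q + 3 * q + b].
Proof.
have r3 : x %% 3 < 3 by lia.
have Ex : x = 3 * (x %/ 3) + x %% 3 by lia.
move: (x %/ 3) (x %% 3) Ex r3 => q [|[|[|r]]] // -> _ {x}; exists q.
- by exists 0, 0; rewrite !addn0 lexedges_mul3; split=> //; lia.
- by exists 0, 1; rewrite !addn0 !addn1 lexedges_mul3D1; split=> //; lia.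
- by exists 1, 1; rewrite !addn1 addn2 lexedges_mul3D2; split=> //; lia.
Qed.

(* Splitting each argument into three balanced parts and applying the induction
   hypothesis to the parts of equal rank leaves three nearly balanced arguments. *)
Lemma lexedges_superadditive (x y z : nat) : z <= y <= x ->
  lexedges x + lexedges y + lexedges z + y + 2 * z <= lexedges (x + y + z).
Proof.
have [m lt_m] := ubnP (x + y + z); elim: m x y z lt_m => // m IH x y z lt_m le_zyx.
(* For [x <= 1] splitting need not shrink the arguments, but they are then already nearly balanced
   around [z]. *)
have [x1|x_gt1] := leqP x 1.
  have := lexedges_near_balanced z (x - z) (y - z).
  have -> : z + (x - z) = x by lia.
  have -> : z + (y - z) = y by lia.
  have -> : 3 * z + (x - z) + (y - z) = x + y + z by lia.
  by move=> H; have := H ltac:(lia); lia.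
have [qx [bx [ax [hx Ex Fx]]]] := ternary_split x.
have [qy [byy [ay [hy Ey Fy]]]] := ternary_split y.
have [qz [bz [az [hz Ez Fz]]]] := ternary_split z.
have I0 := IH (qx + ax) (qy + ay) (qz + az) ltac:(lia) ltac:(lia).
have I1 := IH (qx + bx) (qy + byy) (qz + bz) ltac:(lia) ltac:(lia).
have I2 := IH qx qy qz ltac:(lia) ltac:(lia).
have := lexedges_near_balanced (qx + qy + qz) (ax + ay + az) (bx + byy + bz) ltac:(lia).
have -> : qx + qy + qz + (ax + ay + az) = qx + ax + (qy + ay) + (qz + az) by lia.
have -> : qx + qy + qz + (bx + byy + bz) = qx + bx + (qy + byy) + (qz + bz) by lia.
have -> : 3 * (qx + qy + qz) + (ax + ay + az) + (bx + byy + bz) = x + y + z by lia.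
lia.
Qed.

(* The ternary expansion of [3 ^ n %/ 2] is 1...1. *)
Lemma halfpow3S (n : nat) : 3 ^ n.+1 %/ 2 = 3 * (3 ^ n %/ 2) + 1.
Proof.
have : odd (3 ^ n) by rewrite oddX orbT.
rewrite expnS; lia.
Qed.

Lemma digitsum_halfpow3 (n : nat) : digitsum (3 ^ n %/ 2) = n.
Proof.
by elim: n => // n IH; rewrite halfpow3S digitsum_digit // IH addn1.
Qed.

(** The ranks below $1\ldots1$ have average digit sum $n-1$. In the induction the layers have sizes
    $k+1,k,k$, and the extra vertex contributes its digit sum $n$. *)
Lemma lexedges_halfpow3 (n : nat) : lexedges (3 ^ n %/ 2) + 3 ^ n %/ 2 = n * (3 ^ n %/ 2).
Proof.
elim: n => [|n IH]; first by rewrite lexedges0.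
rewrite halfpow3S addn1 lexedges_mul3D1 lexedgesS digitsum_halfpow3; nia.
Qed.

(** * The cube as a product with a triangle *)

Definition fcons {n : nat} (c : 'I_3) (x : {ffun 'I_n -> 'I_3}) :
    {ffun 'I_n.+1 -> 'I_3} :=
  [ffun j => if unlift ord0 j is Some i then x i else c].

Definition ftail {n : nat} (x : {ffun 'I_n.+1 -> 'I_3}) : {ffun 'I_n -> 'I_3} :=
  [ffun j => x (lift ord0 j)].

Lemma fcons0 (n : nat) (c : 'I_3) (x : {ffun 'I_n -> 'I_3}) : fcons c x ord0 = c.
Proof. by rewrite ffunE unlift_none. Qed.

Lemma fconsS (n : nat) (c : 'I_3) (x : {ffun 'I_n -> 'I_3}) (j : 'I_n) :
  fcons c x (lift ord0 j) = x j.
Proof. by rewrite ffunE liftK. Qed.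

Lemma ftail_fcons (n : nat) (c : 'I_3) (x : {ffun 'I_n -> 'I_3}) :
  ftail (fcons c x) = x.
Proof. by apply/ffunP => j; rewrite ffunE fconsS. Qed.

Lemma fcons_ftail (n : nat) (x : {ffun 'I_n.+1 -> 'I_3}) :
  fcons (x ord0) (ftail x) = x.
Proof.
by apply/ffunP => j; rewrite ffunE; case: unliftP => [i|] ->; rewrite ?ffunE.
Qed.

Lemma sum_fcons (n : nat) (G : {ffun 'I_n.+1 -> 'I_3} -> nat) :
  \sum_x G x = \sum_c \sum_x G (fcons c x).
Proof.
rewrite (pair_big xpredT xpredT (fun c x => G (fcons c x))) /=.
rewrite (reindex (fun p : 'I_3 * {ffun 'I_n -> 'I_3} => fcons p.1 p.2)) //=.
exists (fun x : {ffun 'I_n.+1 -> 'I_3} => (x ord0, ftail x)) => [[c x] _ | x _] /=.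
  by rewrite fcons0 ftail_fcons.
exact: fcons_ftail.
Qed.

(** Distinct residues modulo 3 always differ by $\pm1$, so adjacency is Hamming distance one. *)
Lemma Q3_adjE (n : nat) (x y : {ffun 'I_n -> 'I_3}) :
  Q3_adj x y = (\sum_j (x j != y j) == 1).
Proof.
rewrite /Q3_adj (_ : [forall j, _] = true) ?andbT.
  by rewrite -sum1_card big_mkcond; congr (_ == _); apply: eq_bigr => j _;
     rewrite inE; case: (_ != _).
apply/forallP => j; case: (x j) (y j) => [[|[|[|a]]] ha] [[|[|[|b]]] hb] //.
Qed.

Lemma Q3_adj_fcons (n : nat) (c d : 'I_3) (x y : {ffun 'I_n -> 'I_3}) :
  Q3_adj (fcons c x) (fcons d y) =
  (if c == d then Q3_adj x y else x == y).
Proof.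
rewrite !Q3_adjE big_ord_recl !fcons0.
rewrite (eq_bigr (fun j => nat_of_bool (x j != y j))) => [|j _]; last by rewrite !fconsS.
case: (eqVneq c d) => [_|_] //=; rewrite add1n eqSS sum_nat_eq0.
apply/forallP/eqP => [h|-> j]; last by rewrite eqxx.
by apply/ffunP => j; have /implyP/(_ isT) := h j; case: (eqVneq (x j) (y j)).
Qed.

Lemma Q3_degree (n : nat) (x : {ffun 'I_n -> 'I_3}) :
  \sum_y Q3_adj x y = 2 * n.
Proof.
elim: n x => [|n IH] x.
  rewrite big1 // => y _; rewrite Q3_adjE big_ord0 //.
rewrite -[x]fcons_ftail sum_fcons (bigD1 (x ord0)) //=.
under eq_bigr => y _ do rewrite Q3_adj_fcons eqxx.
rewrite IH.
have -> : \sum_(c | c != x ord0) \sum_y Q3_adj (fcons (x ord0) (ftail x)) (fcons c y)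
     = \sum_(c | c != x ord0) 1.
  apply: eq_bigr => c ne; under eq_bigr => y _ do rewrite Q3_adj_fcons eq_sym (negPf ne).
  rewrite (bigD1 (ftail x)) //= eqxx big1 // => y /negPf; by rewrite eq_sym => ->.
rewrite sum1_card cardC1 card_ord; lia.
Qed.

(** * Edge boundary and Lindsey's inequality *)

Definition boundary {n : nat} (S : {set {ffun 'I_n -> 'I_3}}) : nat :=
  \sum_x \sum_y [&& Q3_adj x y, x \in S & y \notin S].

Definition slice {n : nat} (S : {set {ffun 'I_n.+1 -> 'I_3}}) (c : 'I_3) :
  {set {ffun 'I_n -> 'I_3}} := [set x | fcons c x \in S].

Lemma card_slice (n : nat) (S : {set {ffun 'I_n.+1 -> 'I_3}}) :
  #|S| = \sum_c #|slice S c|.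
Proof.
rewrite -sum1_card big_mkcond sum_fcons; apply: eq_bigr => c _.
by rewrite -sum1_card [RHS]big_mkcond; apply: eq_bigr => x _; rewrite inE.
Qed.

(** A cut edge either stays in a slice or joins the two copies of one [x] lying in slice [c] but not
    in slice [d]. *)
Lemma boundary_slice (n : nat) (S : {set {ffun 'I_n.+1 -> 'I_3}}) :
  boundary S =
  \sum_c (boundary (slice S c) +
          \sum_d #|slice S c :\: slice S d|).
Proof.
rewrite /boundary sum_fcons; apply: eq_bigr => c _.
under eq_bigr => x _ do rewrite sum_fcons.
rewrite exchange_big /= (bigD1 c) //= [in RHS](bigD1 c) //= setDv cards0 add0n.
congr (_ + _).
  by apply: eq_bigr => x _; apply: eq_bigr => y _; rewrite Q3_adj_fcons eqxx !inE.
apply: eq_bigr => d ne; rewrite -sum1_card [RHS]big_mkcond; apply: eq_bigr => x _.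
rewrite (bigD1 x) //= big1 => [|y /negPf ne_yx].
  rewrite Q3_adj_fcons eq_sym (negPf ne) eqxx !inE addn0 andTb.
  by case: (_ \in S) (_ \in S) => [] [].
by rewrite Q3_adj_fcons eq_sym (negPf ne) eq_sym ne_yx.
Qed.

Lemma leq_cardD (T : finType) (A B : {set T}) : #|A| - #|B| <= #|A :\: B|.
Proof. by rewrite cardsD; have := subset_leq_card (subsetIr A B); lia. Qed.

(** Order-free form of superadditivity: the truncated differences bound the cut edges between slices
    from below, and for $x\ge y\ge z$ they add up to $2(x-z)$. *)
Lemma lexedges_superadditive_any (x y z : nat) :
  2 * (lexedges x + lexedges y + lexedges z + (x + y + z))
    <= 2 * lexedges (x + y + z) + ((x - y) + (x - z) + (y - x) + (y - z) + (z - x) + (z - y)).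
Proof.
wlog le_yx : x y / y <= x => [IH|].
  by case: (leqP y x) => [|/ltnW] /IH //; rewrite (addnC y x); lia.
have [le_zy|lt_yz] := leqP z y.
  by have := lexedges_superadditive x y z; lia.
have [le_zx|lt_xz] := leqP z x.
  by have := lexedges_superadditive x z y; rewrite (addnAC x z y); lia.
have := lexedges_superadditive z x y.
have -> : z + x + y = x + y + z by lia.
lia.
Qed.

Definition digit0 : 'I_3 := @Ordinal 3 0 isT.
Definition digit1 : 'I_3 := @Ordinal 3 1 isT.
Definition digit2 : 'I_3 := @Ordinal 3 2 isT.

Lemma sum_I3 (F : 'I_3 -> nat) : \sum_c F c = F digit0 + F digit1 + F digit2.
Proof.
rewrite !big_ord_recl big_ord0 addn0 addnA.
by congr (F _ + F _ + F _); apply: val_inj.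
Qed.

(* Lindsey's edge-isoperimetric inequality. *)
Lemma boundary_lower (n : nat) (S : {set {ffun 'I_n -> 'I_3}}) :
  2 * n * #|S| <= boundary S + 2 * lexedges #|S|.
Proof.
elim: n S => [|n IH] S; first by rewrite muln0 mul0n.
rewrite card_slice boundary_slice.
rewrite !sum_I3 !setDv !cards0.
move: (slice S digit0) (slice S digit1) (slice S digit2) => s0 s1 s2.
have := lexedges_superadditive_any #|s0| #|s1| #|s2|.
have := (IH s0, IH s1, IH s2) => -[[h0 h1] h2].
have := (leq_cardD _ s0 s1, leq_cardD _ s0 s2, leq_cardD _ s1 s0).
have := (leq_cardD _ s1 s2, leq_cardD _ s2 s0, leq_cardD _ s2 s1).
move=> [[]] ? ? ? [[]] ? ? ?.
rewrite [n.+1]lock !mulnDr -lock; lia.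
Qed.

(** * The nested optimal cuts *)

(* Spine position of a vertex in an optimal placement, which sends 1...1 to the
   root (level 2), its lexicographic predecessor and successor to the joints
   (levels 1 and 3), and the vertices below and above these to the two stars. *)
Fixpoint level (n : nat) : {ffun 'I_n -> 'I_3} -> nat :=
  if n is n'.+1 return {ffun 'I_n -> 'I_3} -> nat then fun x =>
    if x ord0 == digit1 then level n' (ftail x)
    else if x ord0 == digit0 then (n' == 0) : nat else 4 - (n' == 0)
  else fun=> 2.

Definition levelset (n t : nat) : {set {ffun 'I_n -> 'I_3}} :=
  [set x | level n x <= t].

Lemma slice_levelset (n t : nat) : t < 4 ->
  [/\ slice (levelset n.+2 t) digit0 = setT,
      slice (levelset n.+2 t) digit1 = levelset n.+1 t &
      slice (levelset n.+2 t) digit2 = set0].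
Proof.
move=> t4; split; apply/setP => x; rewrite !inE [level _ _]/= fcons0 ?ftail_fcons //=.
by apply/negbTE; rewrite -ltnNge.
Qed.

(** In dimension one the digits 0, 1, 2 have levels 1, 2, 3: joint, root, joint. *)
Lemma slice_levelset1 (t : nat) : t < 4 ->
  [/\ slice (levelset 1 t) digit0 = if 0 < t then setT else set0,
      slice (levelset 1 t) digit1 = if 1 < t then setT else set0 &
      slice (levelset 1 t) digit2 = if 2 < t then setT else set0].
Proof.
move=> t4; split; apply/setP => x; rewrite !inE [level _ _]/= fcons0 ?ftail_fcons //=;
  by case: t t4 => [|[|[|[|t]]]] // _; rewrite inE.
Qed.

Lemma card_levelset (n t : nat) : t < 4 ->
  #|levelset n.+1 t| + 1 = 3 ^ n.+1 %/ 2 + t.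
Proof.
move=> t4; elim: n => [|n IH]; rewrite card_slice sum_I3.
  have [-> -> ->] := slice_levelset1 t t4.
  have c1 : #|[set: {ffun 'I_0 -> 'I_3}]| = 1 by rewrite cardsT card_ffun !card_ord.
  by case: t t4 => [|[|[|[|t]]]] //= _; rewrite ?c1 ?cards0.
have [-> -> ->] := slice_levelset n t t4.
rewrite cardsT card_ffun !card_ord cards0 halfpow3S.
have : odd (3 ^ n.+1) by rewrite oddX orbT.
lia.
Qed.

Lemma boundary0 (n : nat) : boundary (set0 : {set {ffun 'I_n -> 'I_3}}) = 0.
Proof. by apply: big1 => x _; apply: big1 => y _; rewrite !inE andbF. Qed.

Lemma boundaryT (n : nat) : boundary (setT : {set {ffun 'I_n -> 'I_3}}) = 0.
Proof. by apply: big1 => x _; apply: big1 => y _; rewrite !inE !andbF. Qed.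

(** A new coordinate has slices [setT], $L$, [set0]. The edges between them number
    $|L^c|+3^{n+1}+|L|=2\cdot 3^{n+1}$, whatever the size of $L$. *)
Lemma boundary_levelset (n t : nat) : t < 4 ->
  boundary (levelset n.+1 t) + 2 * ((t == 0) + (t == 3)) = 2 * (3 ^ n.+1 %/ 2).
Proof.
move=> t4; elim: n => [|n IH]; rewrite boundary_slice !sum_I3.
  have [-> -> ->] := slice_levelset1 t t4.
  have c1 : #|[set: {ffun 'I_0 -> 'I_3}]| = 1 by rewrite cardsT card_ffun !card_ord.
  case: t t4 => [|[|[|[|t]]]] //= _; rewrite ?boundary0 ?boundaryT;
    by rewrite ?setDv ?setD0 ?set0D ?cards0 ?c1.
have [-> -> ->] := slice_levelset n t t4.
rewrite !setDv !setD0 !set0D setDT boundary0 boundaryT !cards0.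
have := cardsC (levelset n.+1 t); rewrite -setTD.
rewrite cardsT card_ffun !card_ord halfpow3S.
have : odd (3 ^ n.+1) by rewrite oddX orbT.
lia.
Qed.

Lemma boundary_near_half (n t : nat) (S : {set {ffun 'I_n.+1 -> 'I_3}}) :
  t < 4 -> #|S| + 1 = 3 ^ n.+1 %/ 2 + t ->
  2 * (3 ^ n.+1 %/ 2) <= boundary S + 2 * ((t == 0) + (t == 3)).
Proof.
move=> t4 cS; have := boundary_lower n.+1 S.
have := lexedges_halfpow3 n.+1; have := digitsum_halfpow3 n.
move: cS; rewrite halfpow3S.
move: (3 ^ n %/ 2) => k cS sk Fk.
(* The half of $3^{n+1}$ is now $3k+1$. The digit sums $n$, $n+1$, $n+2$ carry its known [lexedges]
   to the four sizes $3k,\ldots,3k+3$. *)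
have F0 := lexedgesS (3 * k + 0); rewrite digitsum_digit // sk in F0.
have F1 := lexedgesS (3 * k + 1); rewrite digitsum_digit // sk in F1.
have F2 := lexedgesS (3 * k + 2); rewrite digitsum_digit // sk in F2.
have E0 : (3 * k + 0).+1 = 3 * k + 1 by lia.
have E1 : (3 * k + 1).+1 = 3 * k + 2 by lia.
have E2 : (3 * k + 2).+1 = 3 * k + 3 by lia.
rewrite E0 in F0; rewrite E1 in F1; rewrite E2 in F2.
have -> : #|S| = 3 * k + t by lia.
by case: t t4 cS => [|[|[|[|t]]]] //= _ cS; nia.
Qed.

(** * Edge sums and distances in the banana tree *)

(** The rank comparison picks one orientation of each edge. A distance split into two asymmetric
    shares thus becomes a sum over ordered pairs. *)
Lemma sum_edges (T : finType) (e : rel T) (g : T -> T -> nat) :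
  symmetric e -> irreflexive e ->
  \sum_(p : T * T | e p.1 p.2 && (enum_rank p.1 < enum_rank p.2))
     (g p.1 p.2 + g p.2 p.1) = \sum_x \sum_y e x y * g x y.
Proof.
move=> e_sym e_irr; rewrite big_split /=.
rewrite (pair_big xpredT xpredT (fun x y => e x y * g x y)) /=.
transitivity (\sum_(p : T * T | e p.1 p.2) g p.1 p.2); last first.
  by rewrite big_mkcond; apply: eq_bigr => p _; case: (e _ _); rewrite ?mul1n.
rewrite [RHS](bigID (fun p => enum_rank p.1 < enum_rank p.2)) /=; congr (_ + _).
rewrite (reindex_inj (h := fun p : T * T => (p.2, p.1))) /=; last by move=> [a b] [c d] [-> ->].
apply: eq_bigl => -[x y] /=; rewrite e_sym -leqNgt ltn_neqAle.
case: (eqVneq x y) => [->|ne]; first by rewrite e_irr.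
by rewrite val_eqE (inj_eq enum_rank_inj) eq_sym ne.
Qed.

Lemma bigmin_leq (I : eqType) (r : seq I) (P : pred I) (F : I -> nat) (m : nat) (i : I) :
  i \in r -> P i -> \big[minn/m]_(j <- r | P j) F j <= F i.
Proof.
elim: r => // j r IH; rewrite inE big_cons => /orP[/eqP <-|ir] Pi.
  by rewrite Pi geq_minl.
by case: ifP => _; [rewrite geq_min IH ?orbT | exact: IH].
Qed.

Lemma gdist_eq (G : sgraph) (x y : G) (m : nat) :
  m < #|G| -> walk_of_length x y m ->
  (forall d, walk_of_length x y d -> m <= d) -> gdist x y = m.
Proof.
move=> ltm wm min_m; apply/eqP; rewrite eqn_leq /gdist; apply/andP; split.
  exact: (bigmin_leq _ _ (fun d : 'I_#|G| => walk_of_length x y d)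
            (fun d => nat_of_ord d) _ (Ordinal ltm) (mem_index_enum _)).
apply: (big_ind (fun v => m <= v)) => [|a b ha hb|d]; [exact: ltnW| |exact: min_m].
by rewrite leq_min ha.
Qed.

Lemma walk_of_lengthP (G : sgraph) (x y : G) (d : nat) :
  reflect (exists p, [/\ path (@sedge G) x p, last x p = y & size p = d])
          (walk_of_length x y d).
Proof.
apply: (iffP existsP) => [[p /andP[pp /eqP lp]]|[p [pp lp <-]]].
  by exists p; rewrite size_tuple.
by exists (in_tuple p); rewrite pp lp eqxx.
Qed.

(* Position along the spine centre, joint, root, joint, centre; a pendant vertex
   gets the position of its centre. *)
Definition spine {k : nat} (u : option ('I_2 * 'I_k)) : nat :=
  if u is Some (i, a) then
    if i == 0 :> nat then (a == 1 :> nat) : nat else 4 - (a == 1 :> nat)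
  else 2.

Definition pendant {k : nat} (u : option ('I_2 * 'I_k)) : bool :=
  if u is Some (_, a) then 1 < a else false.

(** Truncated subtraction leaves one share to each endpoint, the form [sum_edges] needs. Equal
    vertices are set apart since a pendant would otherwise be at distance 2 from itself. *)
Definition tdist {k : nat} (u v : option ('I_2 * 'I_k)) : nat :=
  if u == v then 0
  else pendant u + (spine v - spine u) + (pendant v + (spine u - spine v)).

Lemma spine_le4 (k : nat) (u : option ('I_2 * 'I_k)) : spine u <= 4.
Proof. by case: u => [[i a]|] //=; case: ifP => _; lia. Qed.

Lemma some_pair_eqE (k : nat) (i j : 'I_2) (a b : 'I_k) :
  (Some (i, a) == Some (j, b)) = (i == j :> nat) && (a == b :> nat).
Proof. by []. Qed.

Lemma tdist_adj (k : nat) (u w v : option ('I_2 * 'I_k)) :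
  banana_adj u w -> tdist u v <= (tdist w v).+1.
Proof.
rewrite /tdist.
case: u => [[[[|[|i]] hi] [a ha]]|]; case: w => [[[[|[|j]] hj] [b hb]]|];
  case: v => [[[[|[|l]] hl] [c hc]]|] //=;
  rewrite /star_adj ?some_pair_eqE -?val_eqE /=; do ?[case: ifP => ?]; lia.
Qed.

(** A descent step towards [v]. With [tdist_adj], which bounds every walk from below, it identifies
    [tdist] as the graph distance. *)
Lemma tdist_next (k d : nat) (u v : option ('I_2 * 'I_k)) :
  1 < k -> tdist u v = d.+1 -> exists2 w, banana_adj u w & tdist w v = d.
Proof.
move=> k1; have k0 : 0 < k by lia.
pose centre i : option ('I_2 * 'I_k) := Some (i, Ordinal k0).
pose joint i : option ('I_2 * 'I_k) := Some (i, Ordinal k1).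
case: u => [[i [[|[|a]] ha]]|] Ed.
- case: v Ed => [[j [b hb]]|] Ed.
    (* A centre steps directly to a pendant [v] of its own star, and otherwise to its joint. *)
    case: (boolP ((i == j) && (1 < b))) => [/andP[/eqP E b1]|nb]; first subst j.
      exists (Some (i, Ordinal hb)); first by rewrite /= /star_adj eqxx -?val_eqE /=; lia.
      by move: Ed; rewrite /tdist !some_pair_eqE /= !eqxx /=; do ?[case: ifP => ?]; lia.
    exists (joint i); first by rewrite /= /star_adj eqxx.
    move: nb Ed; rewrite /tdist !some_pair_eqE /= -val_eqE.
    by case: i j => [[|[|i]] hi] [[|[|j]] hj] //=; do ?[case: ifP => ?]; lia.
  exists (joint i); first by rewrite /= /star_adj eqxx.
  by move: Ed; rewrite /tdist /=; case: i => [[|[|i]] hi] //=; do ?[case: ifP => ?]; lia.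
- case: v Ed => [[j [b hb]]|] Ed.
    case: (eqVneq i j) => [E|ne].
      subst j; exists (centre i); first by rewrite /= /star_adj eqxx.
      move: Ed; rewrite /tdist !some_pair_eqE /=.
      by case: i => [[|[|i]] hi] //=; do ?[case: ifP => ?]; lia.
    exists None => //; move: ne Ed; rewrite /tdist !some_pair_eqE /= -val_eqE.
    by case: i j => [[|[|i]] hi] [[|[|j]] hj] //=; do ?[case: ifP => ?]; lia.
  by exists None => //; move: Ed; rewrite /tdist /=; case: i => [[|[|i]] hi] //=; do ?[case: ifP => ?]; lia.
- exists (centre i); first by rewrite /= /star_adj eqxx.
  move: Ed; case: v => [[j [b hb]]|]; rewrite /tdist ?some_pair_eqE /=;
    case: i => [[|[|i]] hi] //=; try by [do ?[case: ifP => ?]; lia];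
    by case: j => [[|[|j]] hj] //=; do ?[case: ifP => ?]; lia.
- case: v Ed => [[j [b hb]]|] //= Ed; exists (joint j) => //.
  move: Ed; rewrite /tdist ?some_pair_eqE /=.
  by case: j => [[|[|j]] hj] //=; do ?[case: ifP => ?]; lia.
Qed.

Lemma tdist_eq0 (k : nat) (u v : option ('I_2 * 'I_k)) : tdist u v = 0 -> u = v.
Proof.
rewrite /tdist; case: eqVneq => // ne E; exfalso.
case: u v ne E => [[i [a ha]]|] [[j [b hb]]|] //; rewrite ?some_pair_eqE.
- by move: i j => [[|[|i]] hi] [[|[|j]] hj] //=; lia.
- by move=> _ /=; case: ifP; lia.
- by move=> _ /=; case: ifP; lia.
Qed.

Lemma gdist_banana (k : nat) (u v : banana 2 k) : 3 < k -> gdist u v = tdist u v.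
Proof.
move=> k3; apply: gdist_eq.
- rewrite card_option card_prod !card_ord /tdist; case: ifP => // _.
  (* [tdist] is at most $1+1+4$, below the $2k+1$ vertices. *)
  have := spine_le4 k u; have := spine_le4 k v.
  by case: (pendant u); case: (pendant v); lia.
- apply/walk_of_lengthP; move Ed: (tdist u v) => d.
  elim: d u Ed => [|d IH] u Ed; first by exists [::]; split=> //; exact: tdist_eq0.
  have [//|w uw /IH[p [pp lp sp]]] := tdist_next k d u v (ltn_trans _ k3) Ed.
  by exists (w :: p); rewrite /= pp uw sp.
- move=> d /walk_of_lengthP[p [pp <- <-]].
  elim: p u pp {v} => [|w p IH] u /=; first by rewrite /tdist eqxx.
  by move=> /andP[/tdist_adj uw /IH wp]; apply: leq_trans (uw _) _.
Qed.

(** * Counting along the spine and assembling the wirelength *)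

Lemma sum_banana (k : nat) (G : option ('I_2 * 'I_k.+2) -> nat) (c : 'I_2 -> nat) :
  (forall i (a : 'I_k.+2), 1 < a -> G (Some (i, a)) = c i) ->
  \sum_u G u = G None +
    \sum_i (G (Some (i, inord 0)) + G (Some (i, inord 1)) + k * c i).
Proof.
move=> Gc; rewrite (bigD1 None) //=; congr (_ + _).
rewrite (reindex_omap Some id) /=; last by case.
rewrite (eq_bigl xpredT) => [|p]; last by rewrite /= eqxx.
rewrite (eq_bigr (fun p => G (Some (p.1, p.2)))) => [|[i a] _] //.
rewrite -(pair_big xpredT xpredT (fun i a => G (Some (i, a)))) /=.
apply: eq_bigr => i _; rewrite !big_ord_recl addnA.
congr (G (Some (i, _)) + G (Some (i, _)) + _).
- by apply: val_inj; rewrite /= inordK.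
- by apply: val_inj; rewrite /= inordK.
rewrite (eq_bigr (fun=> c i)) => [|a _]; last by rewrite Gc.
by rewrite sum_nat_const card_ord.
Qed.

Lemma sum_pendant (k : nat) : 1 < k -> \sum_(u : banana 2 k) pendant u = 2 * (k - 2).
Proof.
case: k => [|[|k]] // _; rewrite (sum_banana k _ (fun=> 1)) => [|i a /= -> //].
by rewrite !big_ord_recl big_ord0 /= !inordK //; lia.
Qed.

(** Position 0 holds a centre and its $k-2$ pendants; positions 1, 2, 3 hold one vertex each. *)
Lemma card_spine (k t : nat) : 1 < k -> t < 4 ->
  #|[set u : banana 2 k | spine u <= t]| + 1 = k + t.
Proof.
case: k => [|[|k]] // _ t4; rewrite -sum1_card big_mkcond /=.
rewrite (sum_banana k _ (fun i => if i == 0 :> nat then 1 else 0)) => [|i a a1].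
  rewrite !big_ord_recl big_ord0 !inE /= !inordK //.
  by case: t t4 => [|[|[|[|t]]]] //= _; lia.
rewrite inE /= (gtn_eqF a1); move: i => [[|[|i]] hi] //=.
by rewrite leqNgt t4.
Qed.

Lemma level_le4 (n : nat) (x : {ffun 'I_n -> 'I_3}) : level n x <= 4.
Proof.
elim: n x => [|n IH] x //=; case: ifP => // _.
by case: ifP => _; case: (n == 0).
Qed.

(** Successive differences show that the fibres of [p] and [q] have equal sizes, so they can be
    matched one by one. *)
Lemma bij_of_sublevel_cards (X Y : finType) (p : X -> nat) (q : Y -> nat) (y0 : Y) :
  (forall t, #|[set x | p x <= t]| = #|[set y | q y <= t]|) -> #|X| = #|Y| ->
  exists2 f : X -> Y, bijective f & forall x, q (f x) = p x.
Proof.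
move=> le_card XY.
have le_split (Z : finType) (r : Z -> nat) t :
    #|[set z | r z <= t.+1]| = #|[set z | r z <= t]| + #|[set z | r z == t.+1]|.
  rewrite -cardsUI (_ : _ :&: _ = set0) ?cards0 ?addn0.
    by apply: eq_card => z; rewrite !inE; lia.
  by apply/setP => z; rewrite !inE; lia.
have eq_fib t : #|[set x | p x == t]| = #|[set y | q y == t]|.
  case: t => [|t]; last by have := le_card t.+1; rewrite !le_split le_card; lia.
  have := le_card 0.
  rewrite (_ : [set x | p x <= 0] = [set x | p x == 0]); last by apply/setP => z; rewrite !inE; lia.
  by move=> ->; apply: eq_card => z; rewrite !inE; lia.
pose A t := enum [set x | p x == t]; pose B t := enum [set y | q y == t].
(* Matches elements of equal index in the two fibres; by [lt_ix] the default [y0] is never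
   reached. *)
pose f x := nth y0 (B (p x)) (index x (A (p x))).
have lt_ix x : index x (A (p x)) < size (B (p x)).
  by rewrite -cardE -eq_fib cardE index_mem mem_enum inE.
have qf x : q (f x) = p x.
  by have := mem_nth y0 (lt_ix x); rewrite mem_enum inE => /eqP.
exists f => //; apply: inj_card_bij; last by rewrite XY.
move=> x x' Ef; have Ep : p x = p x' by rewrite -!qf Ef.
move: Ef; rewrite /f Ep => /eqP; rewrite nth_uniq ?enum_uniq //; last by rewrite -Ep.
move=> /eqP Ei; have xA : x \in A (p x') by rewrite mem_enum inE Ep.
have x'A : x' \in A (p x') by rewrite mem_enum inE.
by rewrite -(nth_index x xA) Ei nth_index.
Qed.

Lemma spine_sub (a b : nat) : a <= 4 -> b <= 4 ->
  b - a = \sum_(t < 4) ((a <= t) && ~~ (b <= t)).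
Proof.
by move=> a4 b4; rewrite !big_ord_recl big_ord0 /= /bump /=; lia.
Qed.

Lemma WLf_banana (n k : nat) (f : Q3 n -> banana 2 k) : 3 < k -> bijective f ->
  WLf f = 4 * n * (k - 2) +
          \sum_(t < 4) boundary [set x : {ffun 'I_n -> 'I_3} | spine (f x) <= t].
Proof.
move=> k3 bij_f; have inj_f := bij_inj bij_f.
(* The share of [f x]: its pendant edge, if any, and the spine edges crossed upwards to [f y]. *)
pose g x y := pendant (f x) + (spine (f y) - spine (f x)).
transitivity (\sum_x \sum_y Q3_adj x y * g x y).
  rewrite -(sum_edges _ _ _ (@Q3_adj_sym n) (@Q3_adj_irrefl n)) /WLf.
  apply: eq_bigr => -[x y] /= /andP[xy _]; rewrite gdist_banana // /tdist.
  case: eqVneq => // /inj_f E; by move: xy; rewrite E Q3_adj_irrefl.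
under eq_bigr => x _ do (under eq_bigr => y _ do rewrite mulnDr; rewrite big_split).
rewrite big_split /=; congr (_ + _).
  under eq_bigr => x _ do rewrite -big_distrl Q3_degree.
  rewrite -big_distrr -(reindex f (P := xpredT) (F := fun u => nat_of_bool (pendant u))) /=; last first.
    exact: onW_bij.
  by rewrite sum_pendant; lia.
rewrite /boundary [RHS]exchange_big /=; apply: eq_bigr => x _.
rewrite [RHS]exchange_big /=; apply: eq_bigr => y _.
rewrite spine_sub ?spine_le4 // big_distrr /=; apply: eq_bigr => t _.
by rewrite !inE mulnb.
Qed.

Lemma sum_I4 (F : nat -> nat) : \sum_(t < 4) F t = F 0 + F 1 + F 2 + F 3.
Proof. by rewrite !big_ord_recr big_ord0. Qed.

Theorem theorem5p14 (n : nat) (hn : 2 <= n) :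
  WL_eq (Q3 n) (banana 2 (3 ^ n %/ 2))
    (4 * n * (uphalf (3 ^ n) - 3) + 4 * (uphalf (3 ^ n) - 2)
       + 4 * (uphalf (3 ^ n) - 1)).
Proof.
case: n hn => [|n] // n_gt0; set k := 3 ^ n.+1 %/ 2.
have odd3 : odd (3 ^ n.+1) by rewrite oddX orbT.
have k3 : 3 < k.
  have : 3 ^ 2 <= 3 ^ n.+1 by rewrite leq_pexp2l.
  by rewrite /k; lia.
have -> : uphalf (3 ^ n.+1) = k.+1 by rewrite /k; lia.
have cardQ : #|Q3 n.+1| = #|banana 2 k|.
  by rewrite card_ffun card_option card_prod !card_ord /k; lia.
(* The value is now $4n(k-2)+4(k-1)+4k$, whose last two terms are the four spine cuts. *)
rewrite !subSS.
split=> [|f bij_f].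
  have [t||f bij_f spine_f] :=
    bij_of_sublevel_cards (Q3 n.+1) (banana 2 k) (level n.+1) (@spine k) None.
  (* From position 4 on, both sublevel sets are everything. *)
  - have [t4|t4] := ltnP t 4.
      apply/eqP; rewrite -(eqn_add2r 1) card_spine //; last lia.
      exact/eqP/card_levelset.
    rewrite (_ : [set x | _] = setT); last first.
      by apply/setP => x; rewrite !inE (leq_trans (level_le4 n.+1 x)).
    rewrite (_ : [set u | _] = setT) ?cardsT //.
    by apply/setP => u; rewrite !inE (leq_trans (spine_le4 k u)).
  - exact: cardQ.
  exists f; split=> //; rewrite WLf_banana //.
  rewrite (eq_bigr (fun t : 'I_4 => boundary (levelset n.+1 t))) => [|t _]; last first.
    by congr boundary; apply/setP => x; rewrite !inE spine_f.
  rewrite (sum_I4 (fun t => boundary (levelset n.+1 t))).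
  have := boundary_levelset n 0 isT; have := boundary_levelset n 1 isT.
  have := boundary_levelset n 2 isT; have := boundary_levelset n 3 isT.
  rewrite -/k /=; lia.
rewrite WLf_banana //.
rewrite (sum_I4 (fun t => boundary [set x : {ffun 'I_n.+1 -> 'I_3} | spine (f x) <= t])).
have cut_bound t : t < 4 ->
    2 * k <= boundary [set x : {ffun 'I_n.+1 -> 'I_3} | spine (f x) <= t]
             + 2 * ((t == 0) + (t == 3)).
  move=> t4; apply: boundary_near_half => //; rewrite -/k.
  rewrite -(card_spine k t ltac:(lia) t4); congr (_ + 1).
  rewrite -(on_card_preimset (f := f) (onW_bij _ bij_f)).
  by apply: eq_card => x; rewrite !inE.
have := cut_bound 0 isT; have := cut_bound 1 isT.
have := cut_bound 2 isT; have := cut_bound 3 isT.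
rewrite /=; lia.
Qed.
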